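(* Let $n\ge1$ and $k$ be positive integers and let $\lambda$ be a partition of length at most $n$. Then \[ \widetilde{G}_\lambda\, p_k \;=\; \sum_{\mu}(-1)^{|\mu/\lambda|-c(\mu/\lambda)}\binom{r(\mu/\lambda)-1}{k-c(\mu/\lambda)}\,\widetilde{G}_{\mu}, \] where the sum runs over all partitions $\mu$ of length at most $n$ with $\mu\geq\lambda$ such that $c(\mu/\lambda)\le k$, the skew shape $\mu/\lambda$ is connected, and the maximal ribbon along the northwest border of $\mu/\lambda$ has size at least $k$.
   Context: Let $\beta\neq 0$ be a parameter. For a partition $\lambda=(\lambda_1\ge\dots\ge\lambda_n\ge0)$ of length at most $n$, let \[G_\lambda=\frac{\det\big(x_i^{\lambda_j+n-j}(1+\beta x_i)^{j-1}\big)_{1\le i,j\le n}}{\prod_{1\le i<j\le n}(x_i-x_j)}\] be the Grassmannian Grothendieck polynomial, and set $\widetilde{G}_\lambda(x_1,\dots,x_n)=\beta^{|\lambda|}G_\lambda(x_1/\beta,\dots,x_n/\beta)$, where $|\lambda|=\sum_i\lambda_i$. $p_k=\sum_{i=1}^n x_i^k$. For partitions, $\lambda\le\mu$ means $\lambda_i\le\mu_i$ for all $i$; $\mu/\lambda$ is the skew diagram of boxes of $\mu$ not in $\lambda$; $|\mu/\lambda|=|\mu|-|\lambda|$; $r(\mu/\lambda)$ and $c(\mu/\lambda)$ are the numbers of rows and columns containing boxes of $\mu/\lambda$. Two boxes are adjacent if they share an edge; $\mu/\lambda$ is connected if any two boxes are joined by a chain of adjacent boxes. A ribbon is a connected skew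 shape with no $2\times2$ square. For connected $\mu/\lambda$, the maximal ribbon along the northwest border of $\mu/\lambda$ is the ribbon $\nu/\lambda$ of largest possible size contained in $\mu/\lambda$. *)

(* Defs.v *)
From HB Require Import structures.
From mathcomp Require Import all_boot all_order all_algebra.
From mathcomp Require Export mpoly.

Set Implicit Arguments.
Unset Strict Implicit.
Unset Printing Implicit Defensive.

Import GRing.Theory.
Local Open Scope ring_scope.

(* A partition of length at most n is an n-tuple of naturals, padded with     *)
(* zeros, such that [sorted geq] holds.                                       *)

Section SkewShapes.
Local Open Scope nat_scope.
Variable n : nat.
Implicit Types lam mu nu : n.-tuple nat.

Definition part_le lam mu : Prop := forall i : 'I_n, tnth lam i <= tnth mu i.

(* Boxes are pairs (row, column), both numbered from 0: row i of mu / lam     *)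
(* occupies the columns lam_i, ..., mu_i - 1.                                 *)
Definition skew_boxes lam mu : seq (nat * nat) :=
  [seq (i, j) | i <- iota 0 n,
                j <- iota (nth 0 lam i) (nth 0 mu i - nth 0 lam i)].

Definition skew_size lam mu : nat := sumn mu - sumn lam.

Definition skew_rows lam mu : nat :=
  size (undup [seq b.1 | b <- skew_boxes lam mu]).

Definition skew_cols lam mu : nat :=
  size (undup [seq b.2 | b <- skew_boxes lam mu]).

Definition adjacent : rel (nat * nat) := fun a b =>
  ((a.1 == b.1) && ((a.2 == b.2.+1) || (b.2 == a.2.+1)))
  || ((a.2 == b.2) && ((a.1 == b.1.+1) || (b.1 == a.1.+1))).

Definition skew_connected lam mu : Prop :=
  forall a b, a \in skew_boxes lam mu -> b \in skew_boxes lam mu ->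
    exists p : seq (nat * nat),
      [/\ path adjacent a p, last a p = b & {subset p <= skew_boxes lam mu}].

Definition has_square lam mu : Prop :=
  exists i j,
    {subset [:: (i, j); (i, j.+1); (i.+1, j); (i.+1, j.+1)]
      <= skew_boxes lam mu}.

Definition is_ribbon lam nu : Prop :=
  [/\ sorted geq nu, part_le lam nu, skew_connected lam nu
    & ~ has_square lam nu].

(* nu / lam is a ribbon of largest possible size contained in mu / lam.       *)
Definition max_nw_ribbon lam mu nu : Prop :=
  [/\ is_ribbon lam nu, part_le nu mu
    & forall nu', is_ribbon lam nu' -> part_le nu' mu ->
        skew_size lam nu' <= skew_size lam nu].

End SkewShapes.

Section Grothendieck.
Variables (K : fieldType) (n : nat).
Implicit Types (beta : K) (lam : n.-tuple nat) (x : 'I_n -> K).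

(* With i, j numbered from 0, the exponents n - j and j - 1 of the 1-based    *)
(* formula become n - 1 - j and j. The quotient is meaningful only for        *)
(* pairwise distinct x_i.                                                     *)
Definition grothendieck beta lam x : K :=
  \det (\matrix_(i < n, j < n)
          (x i ^+ (tnth lam j + (n - 1 - j))%N * (1 + beta * x i) ^+ j))
  / \prod_(i < n) \prod_(j < n | (i < j)%N) (x i - x j).

Definition grothendieck_tilde beta lam x : K :=
  beta ^+ sumn lam * grothendieck beta lam (fun i => x i / beta).

Definition power_sum (k : nat) x : K := \sum_(i < n) x i ^+ k.

End Grothendieck.

Section RationalFunctions.
Variables (F : fieldType) (n : nat).

Definition ratfun : fieldType := {fraction {mpoly F[n]}}.

Definition ratfun_const (c : F) : ratfun := tofrac (c%:MP_[n]).

Definition ratfun_var (i : 'I_n) : ratfun := tofrac ('X_i : {mpoly F[n]}).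

(* The Grothendieck polynomials in the indeterminates x_1, ..., x_n: quotients *)
(* of polynomials, taken in the fraction field of F[x_1, ..., x_n].            *)
Definition Gtilde (beta : F) (lam : n.-tuple nat) : ratfun :=
  grothendieck_tilde (ratfun_const beta) lam ratfun_var.

Definition psum (k : nat) : ratfun := power_sum k ratfun_var.

End RationalFunctions.

Arguments psum F n k : clear implicits.

(* Main.v *)
Require Import Defs.
From HB Require Import structures.
From mathcomp Require Import all_boot all_order all_algebra.
From mathcomp Require Import perm zify ring.

Set Implicit Arguments.
Unset Strict Implicit.
Unset Printing Implicit Defensive.

Import GRing.Theory.
Local Open Scope ring_scope.

(* Up to a factor independent of lambda, the rescaled polynomial of lambda is *)
(* the determinant with columns phi_q(lambda_q), q < n (counted from 0), where *)
(* phi_l(m) = x^(m+n-1-l) (1+x)^l, and                                        *)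
(*   phi_(l+1)(m+1) = phi_l(m) + phi_l(m+1).            (1)                   *)
(* Multiplying by p_k yields the sum over j of the determinants with column j *)
(* replaced by phi_j(lambda_j + k). By (1) this column is pushed up through   *)
(* the rows i <= j, any phi_i(lambda_i) being killed by the i-th column; this *)
(* produces the binomial coefficients. The column phi_i(m) so obtained is     *)
(* moved to position i, which shifts phi_l(lambda_l), i <= l < j, to position *)
(* l+1, where (1) expands it with signs into the phi_(l+1)(v) with            *)
(* lambda_l < v <= mu_l. The chains lambda_l < mu_(l+1) <= mu_l are exactly   *)
(* the connected skew shapes with nonempty rows i, ..., j. The maximal ribbon *)
(* has r + c - 1 boxes, so its size is at least k precisely when the binomial *)
(* coefficient of index k - c does not vanish.                                *)

(** * Determinants as alternating functions of their columns *)

(** The multiplication is [wedge_mul_sum]; the upward pass is [climb], whose coefficients obey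
    Pascal's rule [binwS]; the downward pass is [descend], an iteration of [descend_step]. Together
    they give [wedge_mul_power_sum], in which [i] and [j] are the first and last nonempty rows of
    the resulting shape. The rest is a dictionary between chains and shapes. [connected_rows_exist]
    shows that connected shapes are chains. In [connected_rows_size] each [mu_(p+1)] is paired with
    [lam_p]; the unpaired part [mu_i - lam_j] is the number of columns, so the sign exponents of the
    downward pass add up to the size minus the number of columns. [max_nw_ribbonP] turns the ribbon
    condition into an inequality. *)

Section Wedge.
Variables (R : comNzRingType) (n : nat).
Implicit Types (h : nat -> 'I_n -> R) (v : 'I_n -> R).

Definition wedge h : R := \det (\matrix_(i < n, q < n) h q i).

Definition setcol h (q : nat) v : nat -> 'I_n -> R :=
  fun p => if p == q then v else h p.

Lemma eq_wedge h h' :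
  (forall q, (q < n)%N -> h q =1 h' q) -> wedge h = wedge h'.
Proof.
move=> eh; congr (\det _); apply/matrixP=> i q.
by rewrite !mxE eh.
Qed.

Lemma cofactor_setcol h (q : 'I_n) v i :
  cofactor (\matrix_(i < n, p < n) setcol h q v p i) i q =
  cofactor (\matrix_(i < n, q < n) h q i) i q.
Proof.
congr (_ * \det _); apply/matrixP=> a b; rewrite !mxE /setcol.
by rewrite eq_sym (negbTE (neq_bump _ _)).
Qed.

Lemma wedge_setcol h (q : 'I_n) v :
  wedge (setcol h q v) =
  \sum_i v i * cofactor (\matrix_(i < n, q < n) h q i) i q.
Proof.
rewrite /wedge (expand_det_col _ q); apply: eq_bigr => i _.
by rewrite cofactor_setcol mxE /setcol eqxx.
Qed.

Lemma wedge_setcolD h q v w : (q < n)%N ->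
  wedge (setcol h q (fun i => v i + w i)) =
  wedge (setcol h q v) + wedge (setcol h q w).
Proof.
move=> qn; have [o ->] : exists o : 'I_n, q = o by exists (Ordinal qn).
rewrite !wedge_setcol -big_split /=.
by apply: eq_bigr => i _; rewrite mulrDl.
Qed.

Lemma wedge_setcol_sum h q (I : Type) (r : seq I) (P : pred I)
    (c : I -> R) (v : I -> 'I_n -> R) : (q < n)%N ->
  wedge (setcol h q (fun i => \sum_(k <- r | P k) c k * v k i)) =
  \sum_(k <- r | P k) c k * wedge (setcol h q (v k)).
Proof.
move=> qn; have [o ->] : exists o : 'I_n, q = o by exists (Ordinal qn).
rewrite wedge_setcol.
under eq_bigr do rewrite mulr_suml.
rewrite exchange_big /=; apply: eq_bigr => k _.
by rewrite wedge_setcol mulr_sumr; apply: eq_bigr => i _; rewrite mulrA.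
Qed.

Lemma wedge_setcolZ h q c v : (q < n)%N ->
  wedge (setcol h q (fun i => c * v i)) = c * wedge (setcol h q v).
Proof.
move=> qn; have := @wedge_setcol_sum h q unit [:: tt] xpredT (fun=> c) (fun=> v) qn.
rewrite big_seq1 => <-; apply: eq_wedge => p _ i; rewrite /setcol.
by case: eqP; rewrite ?big_seq1.
Qed.

Lemma wedge_alt h p q : (p < q < n)%N -> h p =1 h q -> wedge h = 0.
Proof.
case/andP=> pq qn e; rewrite /wedge -det_tr.
have pn := ltn_trans pq qn.
apply: (@determinant_alternate _ _ _ (Ordinal pn) (Ordinal qn)).
  by rewrite -val_eqE /= neq_ltn pq.
by move=> i; rewrite !mxE /= e.
Qed.

Lemma wedge_swap h h' q : (q.+1 < n)%N ->
  h' q =1 h q.+1 -> h' q.+1 =1 h q ->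
  (forall p, p != q -> p != q.+1 -> h' p =1 h p) -> wedge h' = - wedge h.
Proof.
move=> qn e1 e2 e3; have qn' : (q < n)%N by lia.
pose a := Ordinal qn'; pose b := Ordinal qn.
have ab : a != b by rewrite -val_eqE /=; lia.
rewrite /wedge -[in RHS](mulN1r) -[in LHS]det_tr -[in RHS]det_tr.
have -> : (\matrix_(i < n, p < n) h' p i)^T =
   tperm_mx a b *m (\matrix_(i < n, p < n) h p i)^T.
  rewrite -xrowE; apply/matrixP=> p i; rewrite !mxE.
  case: tpermP => [->|->|pa pb]; rewrite ?e1 ?e2 //.
  apply: e3; apply/eqP=> e; [apply: pa|apply: pb]; exact: val_inj.
by rewrite det_mulmx det_perm odd_tperm ab expr1.
Qed.

(* Expanding along columns on one side and along rows on the other. *)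
Lemma wedge_mul_sum h v :
  wedge h * \sum_i v i = \sum_(q < n) wedge (setcol h q (fun i => v i * h q i)).
Proof.
rewrite [RHS](eq_bigr _ (fun q _ => wedge_setcol h q _)).
rewrite exchange_big mulr_sumr; apply: eq_bigr => i _ /=.
rewrite /wedge (expand_det_row _ i) mulr_suml; apply: eq_bigr => q _.
by rewrite !mxE; ring.
Qed.

End Wedge.

(** * Straightening *)

Section Straightening.
Variables (R : comNzRingType) (n : nat) (phi : nat -> nat -> 'I_n -> R).
Variable lam : nat -> nat.
Hypothesis phiS : forall l m i, (l.+1 < n)%N ->
  phi l.+1 m.+1 i = phi l m i + phi l m.+1 i.
Hypothesis lam_decr : forall p, (lam p.+1 <= lam p)%N.

Let base : nat -> 'I_n -> R := fun q => phi q (lam q).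

(** Relation (1), read as [phi l m = phi l.+1 m.+1 - phi l m.+1] and iterated from [L] to [M]. The
    remainder [phi l M] is kept because, for [M = mu_l], it repeats a column already present. *)
Lemma phi_down l L M i : (l.+1 < n)%N -> (L <= M)%N ->
  phi l L i = - (\sum_(L.+1 <= v < M.+1) (-1) ^+ (v - L) * phi l.+1 v i)
              + (-1) ^+ (M - L) * phi l M i.
Proof.
move=> ln; elim: M => [|M IH]; first by rewrite leqn0 => /eqP->; rewrite big_geq // subnn; ring.
rewrite leq_eqVlt => /orP[/eqP->|LM].
  by rewrite big_geq // subnn; ring.
rewrite IH // [in RHS]big_nat_recr //= phiS // subSn // exprS; ring.
Qed.

(** * Upward pass: binomial coefficients from Pascal's rule *)

Section Climb.
Variables (j N B : nat).
Hypotheses (jn : (j < n)%N) (BN : (B < N)%N) (lamB : (lam j < B)%N).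

(* For [B = lam j + k] and [m = mu i] this is 'C(r - 1, k - c), cut off at the *)
(* bound [c <= k], for the shape with nonempty rows [i .. j].                 *)
Definition binw i m : R := if (m <= B)%N then 'C(j - i, B - m)%:R else 0.

(** Pascal's rule survives the cut-off: at [m = B] the second term is cut to 0 and both remaining
    binomials are 1. *)
Lemma binwS i m : (i < j)%N -> binw i m = binw i.+1 m + binw i.+1 m.+1.
Proof.
move=> ij; rewrite /binw; have -> : (j - i = (j - i.+1).+1)%N by lia.
case: (ltngtP m B) => [mB|mB|->]; rewrite ?addr0 //.
- have -> : (B - m = (B - m.+1).+1)%N by lia.
  by rewrite binS natrD.
- by rewrite subnn !bin0.
Qed.

(** Summation by parts, moving the shift from [d] to [c]. In [climb] both boundary terms vanish: at
    [M] by the cut-off of [binw], at [L] by a repeated column. *)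
Lemma telescope_shift (c d : nat -> R) L M : (L < M)%N ->
  \sum_(L.+1 <= m < M) c m * (d m.-1 + d m) + c M * d M.-1 =
  \sum_(L.+1 <= m < M) (c m + c m.+1) * d m + c L.+1 * d L.
Proof.
elim: M => // M IH; rewrite ltnS leq_eqVlt => /orP[/eqP->|LM].
  by rewrite !big_geq.
rewrite !big_nat_recr //=; have {}IH := IH LM.
transitivity ((\sum_(L.+1 <= m < M) c m * (d m.-1 + d m) + c M * d M.-1)
  + c M * d M + c M.+1 * d M); first by ring.
by rewrite IH; ring.
Qed.

Let D v := wedge (setcol base j v).

Lemma climb :
  D (phi j B) = \sum_(i < j.+1) \sum_(m < N |
      (lam i < m)%N && ((i == 0 :> nat) || (m <= lam i.-1)%N))
    binw i m * D (phi i m).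
Proof.
(* [U i] is what the travelling column contributes when it reaches row [i], before the terms with
   [m <= lam i.-1] are set aside. *)
pose U i := \sum_(m < N | (lam i < m)%N) binw i m * D (phi i m).
have -> : D (phi j B) = U j.
  rewrite /U (bigD1 (Ordinal BN)) //= /binw leqnn !subnn bin0 mul1r.
  rewrite big1 ?addr0 // => m /andP[_ mB]; case: leqP => h; rewrite ?mul0r //.
  have : (m < B)%N by rewrite ltn_neqAle h andbT.
  by rewrite -subn_gt0 => mB'; rewrite bin_small // mul0r.
have UE i : (i <= j)%N -> U i = \sum_(i0 < i.+1) \sum_(m < N |
      (lam i0 < m)%N && ((i0 == 0 :> nat) || (m <= lam i0.-1)%N))
    binw i0 m * D (phi i0 m).
  elim: i => [_|i IH ij].
    by rewrite big_ord1; apply: eq_bigl => m; rewrite andbT.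
  (* The terms of [U i.+1] with [m <= lam i] stop in row [i.+1] and form the new summand; the others
     are rewritten by (1) and must give [U i]. *)
  rewrite big_ord_recr -IH /= 1?ltnW // /U (bigID (fun m : 'I_N => m <= lam i)%N) /=.
  rewrite addrC; congr (_ + _).
  rewrite (eq_bigl (fun m : 'I_N => (lam i < m)%N)); last first.
    by move=> m; have := lam_decr i; lia.
  have cv (F : nat -> R) : \sum_(m < N | (lam i < m)%N) F m = \sum_((lam i).+1 <= m < N) F m.
    by rewrite big_geq_mkord.
  move: (cv (fun m => binw i.+1 m * D (phi i.+1 m))) => /= ->.
  move: (cv (fun m => binw i m * D (phi i m))) => /= ->.
  have [lN|lN] := leqP N (lam i); first by rewrite !big_geq // ltnW.
  have i1n : (i.+1 < n)%N by apply: leq_ltn_trans ij jn.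
  transitivity (\sum_((lam i).+1 <= m < N) binw i.+1 m * (D (phi i m.-1) + D (phi i m))).
    apply: eq_big_nat => -[|m] //= _.
    rewrite -wedge_setcolD //; congr (_ * _); apply: eq_wedge => p _ x.
    by rewrite /setcol; case: eqP => // _; rewrite phiS.
  have := telescope_shift (binw i.+1) (fun m => D (phi i m)) lN.
  have -> : binw i.+1 N = 0 by rewrite /binw leqNgt BN.
  have -> : D (phi i (lam i)) = 0.
    apply: (wedge_alt (p := i) (q := j)); first by rewrite ij.
    by move=> x; rewrite /setcol eqxx ltn_eqF.
  rewrite mul0r mulr0 !addr0 => ->; apply: eq_bigr => m _.
  by rewrite -(binwS m ij).
exact: UE.
Qed.

End Climb.

(** * Downward pass: signs and the lower rows of the shape *)

Section Descend.
Variable (j : nat).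
Hypothesis jn : (j < n)%N.

(* Column [j] of [base] has been moved to position [l], pushing columns       *)
(* [l .. j-1] one step to the right.                                          *)
Definition slid l v q : 'I_n -> R :=
  if (q < l)%N then base q else if q == l then v
  else if (q <= j)%N then base q.-1 else base q.

Lemma wedge_slid l v : (l <= j)%N ->
  wedge (setcol base j v) = (-1) ^+ (j - l) * wedge (slid l v).
Proof.
move=> lj; rewrite -[l in RHS](subKn lj); elim: (j - l)%N (leq_subr l j) => [|d IH] dj.
  rewrite subn0 subnn mul1r; apply: eq_wedge => q qn x; rewrite /setcol /slid.
  by case: ltngtP => // qj; rewrite leqNgt qj.
rewrite IH 1?ltnW // !subKn ?(ltnW dj) // exprS mulN1r mulNr -mulrN; congr (_ * _).
have -> : (j - d = (j - d.+1).+1)%N by lia.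
have : (j - d.+1 < j)%N by lia.
move: (j - d.+1)%N => e ej; apply: (@wedge_swap _ _ _ _ e); first by lia.
- by move=> x; rewrite /slid leqnn ltnNge leqnSn gtn_eqF // ej.
- by move=> x; rewrite /slid !ltnn !eqxx.
- move=> p p1 p2 x; rewrite /slid (negbTE p1) (negbTE p2).
  by have -> : (p < e.+1)%N = (p < e)%N by lia.
Qed.

(** An intermediate state of the descent: columns up to [l] already carry the new parts, while
    columns [l.+1 .. j] still hold the columns of [base] displaced by one. *)
Definition chain_cols l (m : nat -> nat) q : 'I_n -> R :=
  if (q <= l)%N then phi q (m q)
  else if (q <= j)%N then base q.-1 else base q.

(** Column [l.+1] holds the displaced [phi l (lam l)], which [phi_down] expands with [M = m l]. Its
    remainder is a multiple of column [l] and drops out, and its minus sign turns [(-1) ^+ (j - l)]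
    into [(-1) ^+ (j - l.+1)]. *)
Lemma descend_step l N (m : nat -> nat) : (l < j)%N -> (lam l <= m l)%N ->
  (m l < N)%N ->
  (-1) ^+ (j - l) * wedge (chain_cols l m) =
  \sum_(v < N | (lam l < v <= m l)%N) (-1) ^+ (v - lam l) *
    ((-1) ^+ (j - l.+1) *
       wedge (chain_cols l.+1 (fun p => if p == l.+1 then v : nat else m p))).
Proof.
move=> lj lm mN; have ln : (l.+1 < n)%N by lia.
rewrite (eq_bigr (fun v : 'I_N => - (-1) ^+ (j - l) *
  ((-1) ^+ (v - lam l) * wedge (setcol (chain_cols l m) l.+1 (phi l.+1 v))))); last first.
  move=> v _; have -> : (j - l = (j - l.+1).+1)%N by lia.
  rewrite (@eq_wedge _ _ _ (setcol (chain_cols l m) l.+1 (phi l.+1 v))).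
    by rewrite exprS; ring.
  move=> q qn x; rewrite /setcol /chain_cols.
  case: eqP => [->|/eqP qe]; first by rewrite leqnn.
  have -> : (q <= l.+1)%N = (q <= l)%N by lia.
  by [].
rewrite -mulr_sumr -wedge_setcol_sum // mulNr -mulrN; congr (_ * _).
rewrite -mulN1r -wedge_setcolZ //.
have E : wedge (setcol (chain_cols l m) l.+1 (fun i => (-1) ^+ (m l - lam l) * phi l (m l) i)) = 0.
  rewrite wedge_setcolZ // (@wedge_alt _ _ _ l l.+1) ?mulr0 ?ltnSn //.
  by move=> x; rewrite /setcol eqxx ltn_eqF // /chain_cols leqnn.
rewrite -[RHS]addr0 -[X in _ = _ + X]E -wedge_setcolD //; apply: eq_wedge => q qn x.
rewrite /setcol /chain_cols; case: eqP => // ->.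
rewrite ltnn lj /= /base (@phi_down l (lam l) (m l)) // mulN1r; congr (- _ + _).
rewrite big_geq_mkord; apply/esym.
have -> := big_ord_widen_cond N (fun v => lam l < v)%N
  (fun v => (-1) ^+ (v - lam l) * phi l.+1 v x) mN.
by apply: eq_bigl => v; rewrite ltnS.
Qed.

End Descend.
End Straightening.

(** * Sums over chains of rows *)

Section ConnectedRows.
Local Open Scope nat_scope.
Implicit Types lam m : nat -> nat.

(** Row [i] must not extend beyond the row above it, which has no box. For a later row,
    [lam p.-1 < m p] says that it shares the column [lam p.-1] with the row above. *)
Definition connected_row lam m i j p : bool :=
  if p == i then (lam p < m p) && ((p == 0) || (m p <= lam p.-1))
  else if i < p <= j then lam p.-1 < m p <= m p.-1 else m p == lam p.

(* [m / lam] is a connected skew shape whose nonempty rows are [i .. j].      *)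
Definition connected_rows n lam m i j : bool :=
  [&& i <= j, j < n & [forall p : 'I_n, connected_row lam m i j p]].

Lemma connected_rowsP n lam m i j :
  reflect [/\ i <= j, j < n & forall p, p < n -> connected_row lam m i j p]
          (connected_rows n lam m i j).
Proof.
apply: (iffP and3P) => -[ij jn h]; split=> //.
  by move=> p pn; exact: (forallP h (Ordinal pn)).
by apply/forallP => p; apply: h.
Qed.

End ConnectedRows.

Section ChainSums.
Variables (n' N' : nat).
Local Notation n := n'.+1.
Local Notation N := N'.+1.
Local Notation T := {ffun 'I_n -> 'I_N}.
Implicit Type b : T.

(** Shapes are stored in a finite type so that they can index sums; [row_val] reads them as
    functions on [nat], meaningful for [p < n]. *)
Definition row_val b (p : nat) : nat := b (inord p).

Definition set_row b (l v : nat) : T :=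
  [ffun q : 'I_n => if q == l :> nat then inord v else b q].

Lemma row_val_set b l v p : (p < n)%N -> (v < N)%N ->
  row_val (set_row b l v) p = if p == l then v else row_val b p.
Proof.
by move=> pn vN; rewrite /row_val ffunE inordK //; case: eqP => // _; rewrite inordK.
Qed.

Lemma row_valP b b' : (forall p, (p < n)%N -> row_val b p = row_val b' p) -> b = b'.
Proof.
move=> e; apply/ffunP => q; apply: val_inj.
by have := e q (ltn_ord q); rewrite /row_val inord_val.
Qed.

Lemma row_val_lt b p : (row_val b p < N)%N.
Proof. exact: ltn_ord. Qed.

Variable lam : nat -> nat.
Hypothesis lam_decr : forall p, (lam p.+1 <= lam p)%N.
Hypothesis lamN : forall p, (lam p < N)%N.

Lemma sum_single_row (R : nmodType) (F : nat -> R) i : (i < n)%N ->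
  \sum_(v < N | (lam i < v)%N && ((i == 0) || (v <= lam i.-1)%N)) F v =
  \sum_(b : T | connected_rows n lam (row_val b) i i) F (row_val b i).
Proof.
move=> ln; pose b0 : T := [ffun q : 'I_n => inord (lam q)].
have b0E p : (p < n)%N -> row_val b0 p = lam p.
  by move=> pn; rewrite /row_val ffunE !inordK.
rewrite [RHS](reindex_onto (fun v : 'I_N => set_row b0 i v)
                (fun b => b (inord i))) /=; last first.
  move=> b /connected_rowsP[_ _ h]; apply: row_valP => p pn.
  rewrite row_val_set // b0E //; case: eqP => [->//|/eqP pi].
  have := h p pn; rewrite /connected_row (negbTE pi) ifF; last by lia.
  by move/eqP.
apply: eq_big => v; last by rewrite row_val_set // eqxx.
have -> : set_row b0 i v (inord i) = v.
  by apply: val_inj; rewrite -[LHS]/(row_val _ _) row_val_set // eqxx.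
rewrite eqxx andbT; apply/idP/idP.
  move=> h; apply/connected_rowsP; split=> // p pn.
  rewrite /connected_row row_val_set // b0E //; case: eqP => [->//|/eqP pi].
  by rewrite ifF //; lia.
move/connected_rowsP=> [_ _ /(_ i ln)].
by rewrite /connected_row eqxx row_val_set // eqxx.
Qed.

(** Resetting row [l.+1] to [lam] fibres the longer chains over the shorter ones; the fibre is
    parametrised by the value [v] of that row, subject only to the condition linking it to row
    [l]. *)
Lemma sum_next_row (R : nmodType) (F : T -> R) i l : (i <= l)%N -> (l.+1 < n)%N ->
  \sum_(b : T | connected_rows n lam (row_val b) i l.+1) F b =
  \sum_(b : T | connected_rows n lam (row_val b) i l)
    \sum_(v < N | (lam l < v <= row_val b l)%N) F (set_row b l.+1 v).
Proof.
move=> il ln.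
rewrite (partition_big (fun b => set_row b l.+1 (lam l.+1))
  (fun b => connected_rows n lam (row_val b) i l)) /=; last first.
  move=> b /connected_rowsP[_ _ h]; apply/connected_rowsP; split=> //; first by lia.
  move=> p pn; have := h p pn; rewrite /connected_row row_val_set //.
  case: (ltngtP p l.+1) => pl.
  - have -> : (p <= l)%N = true by lia.
    rewrite (row_val_set _ _ (p := p.-1)); [|lia|by []].
  by have -> : (p.-1 == l.+1) = false by lia.
  - by rewrite (_ : (p <= l)%N = false) ?andbF //; lia.
  - move=> _; rewrite pl [(l.+1 <= l)%N]ltnn andbF ifF; last by lia.
    exact: eqxx.
apply: eq_bigr => b /connected_rowsP[_ _ h].
rewrite (reindex_onto (fun v : 'I_N => set_row b l.+1 v)
                (fun b' => b' (inord l.+1))) /=; last first.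
  move=> b' /andP[_ /eqP <-]; apply: row_valP => p pn.
  by rewrite !row_val_set //; case: eqP => // ->.
apply: eq_bigl => v.
have -> : set_row b l.+1 v (inord l.+1) = v.
  by apply: val_inj; rewrite -[LHS]/(row_val _ _) row_val_set // eqxx.
have -> : set_row (set_row b l.+1 v) l.+1 (lam l.+1) = b.
  apply: row_valP => p pn; rewrite !row_val_set //; case: eqP => // ->.
  by have := h l.+1 ln; rewrite /connected_row !ifF; lia.
rewrite !eqxx !andbT; apply/idP/idP.
  move=> /connected_rowsP[_ _ /(_ l.+1 ln)].
  rewrite /connected_row ifF; last by lia.
  rewrite ifT; last by lia.
  by rewrite !row_val_set //; [rewrite eqxx ltn_eqF|lia].
move=> hv; apply/connected_rowsP; split=> //; first by lia.
move=> p pn; have := h p pn; rewrite /connected_row row_val_set //.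
case: (ltngtP p l.+1) => pl.
- have -> : (p <= l)%N = true by lia.
  rewrite (row_val_set _ _ (p := p.-1)); [|lia|by []].
  by have -> : (p.-1 == l.+1) = false by lia.
- by rewrite (_ : (p <= l)%N = false) ?andbF //; lia.
- rewrite pl [(l.+1 <= l)%N]ltnn andbF ifF; last by lia.
  move=> _; rewrite ifF ?ifT; try lia.
  by rewrite row_val_set ?ltn_eqF //; lia.
Qed.

Section Rule.
Variables (R : comNzRingType) (phi : nat -> nat -> 'I_n -> R).
Hypothesis phiS : forall l m i, (l.+1 < n)%N ->
  phi l.+1 m.+1 i = phi l m i + phi l m.+1 i.

Definition chain_sign i j (m : nat -> nat) : R :=
  \prod_(i <= p < j) (-1) ^+ (m p.+1 - lam p).

(** The coefficient [c] stands for the binomial of the upward pass; it depends on the first row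
    only, so the descent leaves it alone. The induction on [l] really starts at [l = i], where
    [wedge_slid] moves the column into place. *)
Lemma descend (c : nat -> R) i j l : (i <= l <= j)%N -> (j < n)%N ->
  \sum_(b : T | connected_rows n lam (row_val b) i i)
    c (row_val b i) * wedge (setcol (fun q => phi q (lam q)) j (phi i (row_val b i))) =
  \sum_(b : T | connected_rows n lam (row_val b) i l)
    c (row_val b i) * (chain_sign i l (row_val b) *
      ((-1) ^+ (j - l) * wedge (chain_cols phi lam j l (row_val b)))).
Proof.
move=> /andP[il lj] jn; elim: l il lj => [|l IH].
  rewrite leqn0 => /eqP-> _; apply: eq_bigr => b _; congr (_ * _).
  rewrite /chain_sign big_geq // mul1r (wedge_slid _ _ _ (l := 0)) //.
  congr (_ * _); apply: eq_wedge => q qn x; rewrite /slid /chain_cols ltn0 leqn0.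
  by case: eqP => // ->.
rewrite leq_eqVlt => /orP[/eqP il|il] lj.
  rewrite -il; apply: eq_bigr => b /connected_rowsP[_ _ h]; congr (_ * _).
  rewrite /chain_sign big_geq // mul1r (wedge_slid _ _ _ (l := i)) ?il //.
  congr (_ * _); apply: eq_wedge => q qn x; rewrite /slid /chain_cols.
  case: (ltngtP q l.+1) => // [ql|->//].
  have := h q qn; rewrite /connected_row il !ifF ?(ltn_eqF ql) //; last by lia.
  by move/eqP=> ->.
rewrite IH // 1?ltnW // sum_next_row //; last by lia.
apply: eq_bigr => b /connected_rowsP[_ _ h].
have hl : (lam l <= row_val b l)%N.
  have ln : (l < n)%N by lia.
  have := h l ln; rewrite /connected_row; case: eqP => [_ /andP[/ltnW]//|/eqP lni].
  by rewrite ifT; [have := lam_decr l.-1; rewrite prednK; lia|lia].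
rewrite (descend_step phiS jn lj hl (row_val_lt _ _)) !mulr_sumr.
apply: eq_bigr => v _.
rewrite row_val_set ?ltn_eqF //; try lia.
congr (_ * _).
rewrite /chain_sign big_nat_recr //= row_val_set // ?eqxx; last by lia.
rewrite -mulrA; congr (_ * (_ * (_ * _))).
  apply: eq_big_nat => p /andP[_ pl].
  by rewrite row_val_set ?ltn_eqF //; lia.
by apply: eq_wedge => q qn x; rewrite /chain_cols row_val_set.
Qed.

Variables (x : 'I_n -> R) (k : nat).
Hypothesis phiX : forall l m i, x i ^+ k * phi l m i = phi l (m + k) i.
Hypothesis k_gt0 : (0 < k)%N.
Hypothesis lamkN : forall p, (lam p + k < N)%N.

Lemma wedge_mul_power_sum :
  wedge (fun q => phi q (lam q)) * \sum_i x i ^+ k =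
  \sum_(j < n) \sum_(i < j.+1)
    \sum_(b : T | connected_rows n lam (row_val b) i j)
      binw R j (lam j + k) i (row_val b i) *
      (chain_sign i j (row_val b) * wedge (fun q => phi q (row_val b q))).
Proof.
rewrite wedge_mul_sum; apply: eq_bigr => j _.
rewrite (@eq_wedge _ _ _ (setcol (fun q => phi q (lam q)) j (phi j (lam j + k)%N))); last first.
  by move=> q qn i; rewrite /setcol; case: eqP => // _; rewrite phiX.
(* The side condition [lam j < lam j + k] is where [k > 0] enters. *)
rewrite (climb phiS lam_decr (ltn_ord j) (lamkN j)) -?addn1 ?leq_add2l //.
rewrite addn1; apply: eq_bigr => i _.
have ij : (i <= j)%N by have := ltn_ord i; lia.
have i_n : (i < n)%N by have := ltn_ord j; lia.
rewrite (sum_single_row (fun v => binw R j (lam j + k) i v *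
  wedge (setcol (fun q => phi q (lam q)) j (phi i v))) i_n).
rewrite (descend _ (l := j)) //; last by rewrite ij /=.
apply: eq_bigr => b /connected_rowsP[_ _ h]; do 2!congr (_ * _).
rewrite subnn mul1r; apply: eq_wedge => q qn y; rewrite /chain_cols.
case: leqP => // jq; have := h q qn; rewrite /connected_row !ifF; try lia.
by move/eqP=> ->.
Qed.

End Rule.
End ChainSums.

(** * Connected skew shapes and their maximal ribbons *)

Section Shapes.
Local Open Scope nat_scope.
Variable n : nat.
Implicit Types lam mu nu : n.-tuple nat.

Lemma nth_partition lam : sorted geq lam ->
  forall p q, p <= q -> nth 0 lam q <= nth 0 lam p.
Proof.
move=> /sortedP-/(_ 0) h p q; elim: q => [|q IH]; first by rewrite leqn0 => /eqP->.
rewrite leq_eqVlt => /orP[/eqP-> //|/IH]; apply: leq_trans.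
have [qn|qn] := ltnP q.+1 (size lam); first exact: h.
by rewrite nth_default.
Qed.

Lemma nth_partition_succ lam : sorted geq lam ->
  forall p, nth 0 lam p.+1 <= nth 0 lam p.
Proof. by move=> h p; apply: nth_partition. Qed.

Lemma sorted_nth lam : (forall p, p.+1 < n -> nth 0 lam p.+1 <= nth 0 lam p) ->
  sorted geq lam.
Proof. by move=> h; apply/(sortedP 0) => p; rewrite size_tuple; apply: h. Qed.

Lemma part_leP lam mu :
  part_le lam mu <-> forall p, nth 0 lam p <= nth 0 mu p.
Proof.
split=> [h p|h q]; last by rewrite !(tnth_nth 0).
have [pn|pn] := ltnP p n; last by rewrite nth_default ?size_tuple.
by have := h (Ordinal pn); rewrite !(tnth_nth 0).
Qed.

Lemma mem_skew_boxes lam mu p q : ((p, q) \in skew_boxes lam mu) =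
  (p < n) && (nth 0 lam p <= q < nth 0 mu p).
Proof.
apply/allpairsPdep/idP => /= [[a [b [+ + [-> ->]]]]|/andP[pn h]].
  by rewrite !mem_iota; lia.
by exists p, q; rewrite !mem_iota; split=> //; lia.
Qed.

Lemma sumn_nth lam : sumn lam = \sum_(0 <= p < n) nth 0 lam p.
Proof. by rewrite sumnE (big_nth 0) size_tuple. Qed.

Section Connected.
Variables (lam mu : n.-tuple nat) (i j : nat).
Hypotheses (lam_part : sorted geq lam).
Hypothesis muP : connected_rows n (nth 0 lam) (nth 0 mu) i j.

Let lamD := nth_partition lam_part.

Lemma connected_rows_le : i <= j. Proof. by case/connected_rowsP: muP. Qed.
Lemma connected_rows_lt : j < n. Proof. by case/connected_rowsP: muP. Qed.
Lemma connected_rows_first : nth 0 lam i < nth 0 mu i.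
Proof.
case/connected_rowsP: muP => ij jn /(_ i (leq_ltn_trans ij jn)).
by rewrite /connected_row eqxx => /andP[].
Qed.
Lemma connected_rows_first_le : 0 < i -> nth 0 mu i <= nth 0 lam i.-1.
Proof.
case/connected_rowsP: muP => ij jn /(_ i (leq_ltn_trans ij jn)).
by rewrite /connected_row eqxx => /andP[_] /predU1P[->|].
Qed.
Lemma connected_rows_mid p : i < p <= j -> nth 0 lam p.-1 < nth 0 mu p <= nth 0 mu p.-1.
Proof.
move=> h; case/connected_rowsP: muP => ij jn /(_ p).
rewrite /connected_row h ifF; last by lia.
by apply; lia.
Qed.
Lemma connected_rows_out p : ~~ (i <= p <= j) -> nth 0 mu p = nth 0 lam p.
Proof.
move=> h; have [pn|pn] := ltnP p n; last by rewrite !nth_default ?size_tuple.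
case/connected_rowsP: muP => ij jn /(_ p pn).
by rewrite /connected_row !ifF => [/eqP//||]; lia.
Qed.
Lemma connected_rows_nonempty p : (nth 0 lam p < nth 0 mu p) = (i <= p <= j).
Proof.
case: (boolP (i <= p <= j)) => [|/connected_rows_out->]; last by rewrite ltnn.
case: (ltngtP i p) => //= [ip pj|<- _]; last exact: connected_rows_first.
by have := connected_rows_mid (p := p); have := @lamD p.-1 p; rewrite ip pj; lia.
Qed.

Lemma connected_rows_sorted : sorted geq mu.
Proof.
apply: sorted_nth => p pn.
case: (boolP (i <= p.+1 <= j)) => [h|h].
  case: (ltngtP i p.+1) h => //= [ip pj|ip pj].
    by have := connected_rows_mid (p := p.+1); rewrite ip pj /=; lia.
  rewrite -ip; have := connected_rows_first_le; rewrite {1}ip => /(_ isT).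
  by rewrite ip /= => h; rewrite (@connected_rows_out p) // ?ip; lia.
rewrite connected_rows_out //; apply: leq_trans (lamD (leqnSn p)) _.
by have := connected_rows_nonempty p; case: (boolP (i <= p <= j)) => [_|/connected_rows_out->//]; lia.
Qed.

Lemma connected_rows_part_le : part_le lam mu.
Proof.
apply/part_leP => p; case: (boolP (i <= p <= j)) => [|/connected_rows_out->//].
by rewrite -connected_rows_nonempty; lia.
Qed.

Lemma connected_rows_rows : skew_rows lam mu = (j - i).+1.
Proof.
rewrite /skew_rows -[RHS](size_iota i); apply: perm_size.
apply: uniq_perm; rewrite ?undup_uniq ?iota_uniq // => p.
rewrite mem_undup mem_iota; apply/mapP/idP => [[[a b]] /= + ->|h].
  by rewrite mem_skew_boxes; have := connected_rows_nonempty a; have := connected_rows_le; lia.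
exists (p, nth 0 lam p) => //; rewrite mem_skew_boxes.
by have := connected_rows_nonempty p; have := connected_rows_le; have := connected_rows_lt; lia.
Qed.

Lemma connected_rows_col_le : nth 0 lam j <= nth 0 mu i.
Proof. by have := lamD connected_rows_le; have := connected_rows_first; lia. Qed.

(** The columns met form the interval from [lam_j] to [mu_i - 1]: if [p] is the least row with
    [lam_p <= q], then column [q] has a box in row [i] when [p <= i], and in row [p] otherwise,
    since there [q < lam_(p-1) < mu_p]. *)
Lemma connected_rows_cols : skew_cols lam mu = nth 0 mu i - nth 0 lam j.
Proof.
rewrite /skew_cols -[RHS](size_iota (nth 0 lam j)); apply: perm_size.
apply: uniq_perm; rewrite ?undup_uniq ?iota_uniq // => q.
rewrite mem_undup mem_iota subnKC ?connected_rows_col_le //.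
apply/mapP/idP => [[[a b]] /= + ->|/andP[h1 h2]].
  rewrite mem_skew_boxes => /andP[an h].
  have /andP[ia aj] : i <= a <= j by rewrite -connected_rows_nonempty; lia.
  by have := nth_partition connected_rows_sorted ia; have := lamD aj; lia.
have ex : exists p, nth 0 lam p <= q by exists j.
case: (ex_minnP ex) => p hp pmin.
have pj := pmin j h1.
have [pi|ip] := leqP p i.
  exists (i, q) => //; rewrite mem_skew_boxes h2 andbT (leq_ltn_trans connected_rows_le connected_rows_lt) /=.
  exact: leq_trans (lamD pi) hp.
exists (p, q) => //; rewrite mem_skew_boxes hp (leq_ltn_trans pj connected_rows_lt) /=.
have := connected_rows_mid (p := p); rewrite ip pj => /(_ isT)/andP[+ _]; apply: leq_trans.
by rewrite ltnS leqNgt; apply/negP => /ltnW/pmin; lia.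
Qed.

Lemma connected_rows_size : skew_size lam mu =
  nth 0 mu i - nth 0 lam j + \sum_(i <= p < j) (nth 0 mu p.+1 - nth 0 lam p).
Proof.
have ij := connected_rows_le; have jn := connected_rows_lt.
rewrite /skew_size !sumn_nth.
rewrite !(@big_cat_nat _ _ _ i 0 n) ?(@big_cat_nat _ _ _ j.+1 i n) //=; try lia.
have -> : \sum_(0 <= p < i) nth 0 mu p = \sum_(0 <= p < i) nth 0 lam p.
  by apply: eq_big_nat => p hp; apply: connected_rows_out; lia.
have -> : \sum_(j.+1 <= p < n) nth 0 mu p = \sum_(j.+1 <= p < n) nth 0 lam p.
  by apply: eq_big_nat => p hp; apply: connected_rows_out; lia.
rewrite big_nat_recl // [X in _ - X](_ : _ = \sum_(0 <= p < i) nth 0 lam p +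
  (\sum_(i <= p < j) nth 0 lam p + nth 0 lam j + \sum_(j.+1 <= p < n) nth 0 lam p)); last first.
  by rewrite big_nat_recr.
have -> : \sum_(i <= p < j) nth 0 mu p.+1 = \sum_(i <= p < j) nth 0 lam p +
    \sum_(i <= p < j) (nth 0 mu p.+1 - nth 0 lam p).
  rewrite -big_split /=; apply: eq_big_nat => p hp.
  by have := connected_rows_mid (p := p.+1); rewrite /=; lia.
by have := connected_rows_col_le; lia.
Qed.

(** The path condition of [skew_connected], with the starting box also required to lie in the shape;
    this makes the relation symmetric. *)
Definition linked (a b : nat * nat) :=
  exists p : seq (nat * nat),
    [/\ path adjacent a p, last a p = b & {subset a :: p <= skew_boxes lam mu}].

Lemma adjacent_sym : symmetric adjacent.
Proof. by move=> a b; rewrite /adjacent; lia. Qed.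

Lemma linked_refl a : a \in skew_boxes lam mu -> linked a a.
Proof. by move=> h; exists [::]; split=> // b; rewrite inE => /eqP->. Qed.

Lemma linked_adj a b : a \in skew_boxes lam mu -> b \in skew_boxes lam mu ->
  adjacent a b -> linked a b.
Proof.
move=> ha hb ab; exists [:: b]; rewrite /= ab; split=> // c.
by rewrite !inE => /orP[]/eqP->.
Qed.

Lemma linked_trans a b c : linked a b -> linked b c -> linked a c.
Proof.
move=> [p [p1 p2 p3]] [q [q1 q2 q3]]; exists (p ++ q).
rewrite cat_path last_cat p1 p2 q1 q2; split=> // d.
rewrite -cat_cons mem_cat => /orP[/p3//|dq]; apply: q3.
by rewrite inE dq orbT.
Qed.

Lemma linked_sym a b : linked a b -> linked b a.
Proof.
move=> [p [p1 <- p3]]; exists (rev (belast a p)); split.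
- rewrite rev_path; rewrite (eq_path (e' := adjacent)) // => c d.
  exact: adjacent_sym.
- by case: p {p1 p3} => //= c p; rewrite rev_cons last_rcons.
- by move=> c h; apply: p3; rewrite lastI mem_rcons inE -mem_rev.
Qed.

Lemma linked_row p q : (p, q) \in skew_boxes lam mu ->
  linked (p, q) (p, nth 0 lam p).
Proof.
elim: q => [|q IH] h; have := h; rewrite mem_skew_boxes => /andP[pn hq].
  by move: h; rewrite (_ : nth 0 lam p = 0); [exact: linked_refl|lia].
have [e|hne] := eqVneq q.+1 (nth 0 lam p); first by rewrite -e; apply: linked_refl.
have h' : (p, q) \in skew_boxes lam mu by rewrite mem_skew_boxes pn /=; lia.
apply: linked_trans (IH h'); apply: linked_adj => //.
by rewrite /adjacent /= !eqxx.
Qed.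

(** Rows [p] and [p.+1] are joined through column [lam_p], where both have a box because
    [lam_p < mu_(p+1) <= mu_p]. *)
Lemma linked_first p q : (p, q) \in skew_boxes lam mu ->
  linked (p, q) (i, nth 0 lam i).
Proof.
elim: p q => [|p IH] q h.
  have i0 : i = 0.
    by move: h; rewrite mem_skew_boxes; have := connected_rows_nonempty 0; lia.
  by rewrite i0; apply: linked_row.
have /andP[ip pj] : i <= p.+1 <= j.
  by move: h; rewrite -connected_rows_nonempty mem_skew_boxes; lia.
have [e|hne] := eqVneq i p.+1; first by rewrite e; apply: linked_row.
have ip' : i < p.+1 by lia.
have hm := connected_rows_mid (p := p.+1); rewrite ip' pj /= in hm.
have {}hm := hm isT; have hl := lamD (leqnSn p); have jn := connected_rows_lt.
have h1 : (p.+1, nth 0 lam p) \in skew_boxes lam mu by rewrite mem_skew_boxes; lia.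
have h2 : (p, nth 0 lam p) \in skew_boxes lam mu by rewrite mem_skew_boxes; lia.
apply: linked_trans (IH _ h2); apply: linked_trans (linked_row h) _.
apply: linked_trans (linked_sym (linked_row h1)) _.
by apply: linked_adj => //; rewrite /adjacent /= !eqxx /= !orbT.
Qed.

Lemma connected_rows_connected : skew_connected lam mu.
Proof.
move=> [a1 a2] [b1 b2] /linked_first ha /linked_first hb.
have [p [p1 p2 p3]] := linked_trans ha (linked_sym hb).
by exists p; split=> // c cp; apply: p3; rewrite inE cp orbT.
Qed.

End Connected.

Lemma connected_rows_unique lam mu i j i' j' : sorted geq lam ->
  connected_rows n (nth 0 lam) (nth 0 mu) i j ->
  connected_rows n (nth 0 lam) (nth 0 mu) i' j' -> i = i' /\ j = j'.
Proof.
move=> hl h h'.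
have e p : (i <= p <= j) = (i' <= p <= j').
  by rewrite -(connected_rows_nonempty hl h) (connected_rows_nonempty hl h').
by move: (e i) (e j) (e i') (e j') (connected_rows_le h) (connected_rows_le h'); lia.
Qed.

(** Take the least and greatest nonempty rows. If some row between them failed to overlap the row
    above, no path could cross there. The empty shape, vacuously connected, is excluded by
    [mu != lam]. *)
Lemma connected_rows_exist lam mu : sorted geq lam -> sorted geq mu ->
  part_le lam mu -> skew_connected lam mu -> mu != lam ->
  exists i j, connected_rows n (nth 0 lam) (nth 0 mu) i j.
Proof.
move=> hl hm /part_leP le conn ne.
have lamD := nth_partition hl; have muD := nth_partition hm.
have ex : exists p, nth 0 lam p < nth 0 mu p.
  have [/existsP[q hq]|] := boolP [exists q : 'I_n, nth 0 lam q < nth 0 mu q].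
    by exists q.
  move/existsPn => h; case/eqP: ne; apply: eq_from_tnth => q; rewrite !(tnth_nth 0).
  by have := h q; have := le q; lia.
have bd p : nth 0 lam p < nth 0 mu p -> p <= n.
  by apply: contraTT; rewrite -ltnNge => pn; rewrite !nth_default ?size_tuple // ltnW.
case: (ex_minnP ex) => i hi imin; case: (ex_maxnP ex bd) => j hj jmax.
have lt_n p : nth 0 lam p < nth 0 mu p -> p < n.
  by apply: contraTT; rewrite -leqNgt => pn; rewrite !nth_default ?size_tuple.
have ij : i <= j := imin j hj.
exists i, j; apply/connected_rowsP; split=> //; first exact: lt_n.
move=> p pn; rewrite /connected_row; case: eqP => [->|/eqP pi].
  rewrite hi /=; case: i {ij} hi imin => //= i hi imin.
  have := muD i i.+1 (leqnSn _); have := imin i; have := le i; lia.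
case: ifP => [/andP[ip pj]|out]; last first.
  have := imin p; have := jmax p; have := le p; lia.
rewrite (muD p.-1 p) ?leq_pred // andbT ltnNge; apply/negP => gap.
have hbi : (i, nth 0 lam i) \in skew_boxes lam mu by rewrite mem_skew_boxes lt_n //=; lia.
have hbj : (j, nth 0 lam j) \in skew_boxes lam mu by rewrite mem_skew_boxes lt_n //=; lia.
have [s [s1 s2 s3]] := conn _ _ hbi hbj.
(* No box of row [p] lies below a box of row [p-1], so a path cannot leave the *)
(* rows above [p].                                                            *)
have stay : forall s a, a \in skew_boxes lam mu -> a.1 < p -> path adjacent a s ->
    {subset s <= skew_boxes lam mu} -> (last a s).1 < p.
  elim=> [|b t IH] a //= ha ap /andP[ab bt] sub.
  have hb : b \in skew_boxes lam mu by apply: sub; rewrite inE eqxx.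
  apply: IH => //; last by move=> c ct; apply: sub; rewrite inE ct orbT.
  rewrite ltnNge; apply/negP => pb.
  case: a b ab ha hb ap pb {bt sub} => [a1 a2] [b1 b2]; rewrite /adjacent /= => ab.
  rewrite !mem_skew_boxes => ha hb ap pb.
  have e : b1 = p /\ a1 = p.-1 /\ a2 = b2 by lia.
  by case: e ha hb => -> [-> ->]; lia.
by have := stay s _ hbi ip s1 s3; rewrite s2 /= ltnNge pj.
Qed.

(** * The maximal ribbon along the northwest border *)

Section Ribbon.
Variables (lam mu : n.-tuple nat) (i j : nat).
Hypotheses (lam_part : sorted geq lam).
Hypothesis muP : connected_rows n (nth 0 lam) (nth 0 mu) i j.

Let lamD := nth_partition lam_part.

(** The first row is kept whole, and every later row overlaps the row above in the single column
    [lam_(p-1)]. *)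
Definition nw_ribbon : n.-tuple nat :=
  [tuple (if p == i :> nat then nth 0 mu i
          else if i < p <= j then (nth 0 lam p.-1).+1 else nth 0 lam p) | p < n].

Lemma nth_nw_ribbon p : p < n -> nth 0 nw_ribbon p =
  if p == i then nth 0 mu i
  else if i < p <= j then (nth 0 lam p.-1).+1 else nth 0 lam p.
Proof.
move=> pn; have := tnth_mktuple (fun p : 'I_n => if p == i :> nat then nth 0 mu i
  else if i < p <= j then (nth 0 lam p.-1).+1 else nth 0 lam p) (Ordinal pn).
by rewrite (tnth_nth 0).
Qed.

Lemma nw_ribbon_rows : connected_rows n (nth 0 lam) (nth 0 nw_ribbon) i j.
Proof.
have [ij jn] := (connected_rows_le muP, connected_rows_lt muP).
apply/connected_rowsP; split=> // p pn; rewrite /connected_row nth_nw_ribbon //.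
case: eqP => [->|/eqP pi].
  have := connected_rows_first_le muP; have := connected_rows_first muP; lia.
case: (boolP (i < p <= j)) => // /andP[ip pj]; rewrite ltnSn /= nth_nw_ribbon; last by lia.
case: eqP => [->|/eqP pi']; first exact: connected_rows_first muP.
by rewrite ifT; [rewrite ltnS lamD ?leq_pred|lia].
Qed.

Lemma nw_ribbon_le : part_le nw_ribbon mu.
Proof.
move=> q; rewrite !(tnth_nth 0) nth_nw_ribbon //; case: eqP => [->//|/eqP qi].
case: ifP => [h|h]; first by case/andP: (connected_rows_mid muP h).
by rewrite (connected_rows_out muP) //; lia.
Qed.

Lemma nw_ribbon_size : skew_size lam nw_ribbon = nth 0 mu i - nth 0 lam j + (j - i).
Proof.
have [ij jn] := (connected_rows_le muP, connected_rows_lt muP).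
rewrite (connected_rows_size lam_part nw_ribbon_rows) nth_nw_ribbon ?eqxx; last by lia.
congr (_ + _); rewrite (eq_big_nat _ _ (F2 := fun=> 1)) ?sum_nat_const_nat ?muln1 //.
move=> p hp; rewrite nth_nw_ribbon; last by lia.
by rewrite ifF ?ifT /= ?subSnn //; lia.
Qed.

Lemma nw_ribbonP : is_ribbon lam nw_ribbon.
Proof.
split; [exact: connected_rows_sorted nw_ribbon_rows|exact: connected_rows_part_le nw_ribbon_rows|exact: connected_rows_connected nw_ribbon_rows|].
move=> [a [b sub]].
have := sub (a, b); have := sub (a.+1, b.+1); rewrite !inE !eqxx /= !orbT.
move=> /(_ isT) h1 /(_ isT) h2; move: h1 h2; rewrite !mem_skew_boxes => /andP[an h1] /andP[_ h2].
have /andP[ia _] : i <= a <= j by rewrite -(connected_rows_nonempty lam_part nw_ribbon_rows); lia.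
have /andP[_ aj] : i <= a.+1 <= j by rewrite -(connected_rows_nonempty lam_part nw_ribbon_rows); lia.
by move: h1; rewrite nth_nw_ribbon // gtn_eqF // ltnS ia aj /=; lia.
Qed.

(** Consecutive rows of a ribbon overlap in at most one column, so its size is at most rows plus
    columns minus 1, and its rows and columns lie among those of [mu / lam]. *)
Lemma ribbon_size_le nu : is_ribbon lam nu -> part_le nu mu ->
  skew_size lam nu <= nth 0 mu i - nth 0 lam j + (j - i).
Proof.
move=> [nu_part nu_ge nu_conn nosq] /part_leP nu_le.
have [->|ne] := eqVneq nu lam; first by rewrite /skew_size subnn.
have [i' [j' nuP]] := connected_rows_exist lam_part nu_part nu_ge nu_conn ne.
have [ij jn] := (connected_rows_le nuP, connected_rows_lt nuP).
have sub p : i' <= p <= j' -> i <= p <= j.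
  by rewrite -(connected_rows_nonempty lam_part nuP) -(connected_rows_nonempty lam_part muP); have := nu_le p; lia.
have /andP[ii _] : i <= i' <= j by apply: sub; lia.
have /andP[_ jj] : i <= j' <= j by apply: sub; lia.
rewrite (connected_rows_size lam_part nuP).
have : \sum_(i' <= p < j') (nth 0 nu p.+1 - nth 0 lam p) <= \sum_(i' <= p < j') 1.
  rewrite big_nat [leqRHS]big_nat; apply: leq_sum => p /andP[ip pj].
  (* An overlap of two columns gives a square with top left box [(p, lam_p)]. *)
  rewrite leqNgt; apply/negP => h; apply: nosq; exists p, (nth 0 lam p).
  have := lamD (leqnSn p); have := nth_partition nu_part (leqnSn p).
  by move=> h1 h2 c; rewrite !inE => /or4P[]/eqP->; rewrite mem_skew_boxes; lia.
rewrite sum_nat_const_nat muln1.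
have := nu_le i'; have := nth_partition (connected_rows_sorted lam_part muP) ii; have := lamD jj.
by have := connected_rows_col_le lam_part nuP; lia.
Qed.

Lemma max_nw_ribbonP k :
  (exists nu, max_nw_ribbon lam mu nu /\ k <= skew_size lam nu) <->
  k <= nth 0 mu i - nth 0 lam j + (j - i).
Proof.
split=> [[nu [[h1 h2 _]]]|h]; first by move/leq_trans; apply; apply: ribbon_size_le.
exists nw_ribbon; rewrite nw_ribbon_size; split=> //; split.
- exact: nw_ribbonP.
- exact: nw_ribbon_le.
- by move=> nu' h1 h2; apply: leq_trans (ribbon_size_le h1 h2) _; rewrite nw_ribbon_size.
Qed.

End Ribbon.
End Shapes.

(** * Expansion of the product *)

Section GrothendieckColumns.
Variables (K : fieldType) (n : nat) (x : 'I_n -> K).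

Definition gcol (l m : nat) (i : 'I_n) : K :=
  x i ^+ (m + (n - 1 - l)) * (1 + x i) ^+ l.

Lemma gcolS l m i : (l.+1 < n)%N ->
  gcol l.+1 m.+1 i = gcol l m i + gcol l m.+1 i.
Proof.
move=> ln; rewrite /gcol; have -> : (n - 1 - l = (n - 1 - l.+1).+1)%N by lia.
by rewrite addSnnS addSn !exprS; ring.
Qed.

Lemma gcolX k l m i : x i ^+ k * gcol l m i = gcol l (m + k) i.
Proof. by rewrite /gcol mulrA -exprD; congr (_ ^+ _ * _); lia. Qed.

(** The part of the rescaled polynomial that does not depend on the partition: the leftover powers
    of [c] and the denominator. It is carried through as a common factor. *)
Definition gfactor (c : K) : K :=
  \prod_(j < n) c ^- (n - 1 - j)
  / \prod_(i < n) \prod_(j < n | (i < j)%N) (x i / c - x j / c).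

Lemma grothendieck_tildeE c (lam : n.-tuple nat) : c != 0 ->
  grothendieck_tilde c lam x =
  gfactor c * wedge (fun q => gcol q (nth 0%N lam q)).
Proof.
move=> c0; rewrite /grothendieck_tilde /grothendieck /gfactor /wedge.
(* [d] collects the power of [1 / c] in each column; its [lam]-dependent part cancels
   [c ^+ sumn lam]. *)
pose d : 'rV[K]_n := \row_j c ^- (tnth lam j + (n - 1 - j)).
have -> : \matrix_(i < n, j < n) ((x i / c) ^+ (tnth lam j + (n - 1 - j))
            * (1 + c * (x i / c)) ^+ j) =
    \matrix_(i < n, q < n) gcol q (nth 0%N lam q) i *m diag_mx d.
  apply/matrixP => i j; rewrite mul_mx_diag !mxE /gcol (tnth_nth 0%N).
  rewrite (_ : c * (x i / c) = x i); last by field.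
  by rewrite expr_div_n; ring.
rewrite det_mulmx det_diag.
have -> : \prod_(j < n) c ^- (n - 1 - j) = c ^+ sumn lam * \prod_j d 0 j.
  have -> : c ^+ sumn lam = \prod_(j < n) c ^+ tnth lam j.
    rewrite sumnE big_tuple.
    exact: (big_morph (fun e => c ^+ e) (exprD c) (expr0 c)).
  rewrite -big_split /=; apply: eq_bigr => j _.
  by rewrite mxE exprD invfM mulrA divff ?mul1r // expf_neq0.
by ring.
Qed.

End GrothendieckColumns.

Lemma eq_connected_rows n lam m m' i j : (forall p, (p < n)%N -> m p = m' p) ->
  connected_rows n lam m i j = connected_rows n lam m' i j.
Proof.
move=> e; have imp f g : (forall p, (p < n)%N -> f p = g p) ->
    connected_rows n lam f i j -> connected_rows n lam g i j.
  move=> fg /connected_rowsP[ij jn h]; apply/connected_rowsP; split=> // p pn.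
  by have := h p pn; rewrite /connected_row !fg //; lia.
by apply/idP/idP; apply: imp => p pn; rewrite e.
Qed.

Section Expansion.
Variables (n' k : nat).
Local Notation n := n'.+1.
Variable lam : n.-tuple nat.
Hypotheses (lam_part : sorted geq lam) (k_gt0 : (0 < k)%N).
Local Notation N' := (nth 0%N lam 0 + k)%N.
Local Notation T := {ffun 'I_n -> 'I_N'.+1}.
Local Notation lamf := (nth 0%N lam).

Definition tuple_of_ffun (b : T) : n.-tuple nat := [tuple row_val b p | p < n].

Lemma nth_tuple_of_ffun b p : (p < n)%N -> nth 0%N (tuple_of_ffun b) p = row_val b p.
Proof.
by move=> pn; rewrite -[p]/(nat_of_ord (Ordinal pn)) -tnth_nth tnth_mktuple.
Qed.

Lemma tuple_of_ffun_inj : injective tuple_of_ffun.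
Proof.
move=> b b' e; apply: row_valP => p pn.
by rewrite -!nth_tuple_of_ffun // e.
Qed.

(** In terms of columns [c] and rows [r] of the shape: [c <= k <= c + r - 1], the range in which the
    binomial coefficient is nonzero as an integer. *)
Definition in_range (m : nat -> nat) (i j : nat) : bool :=
  (m i - lamf j <= k <= m i - lamf j + (j - i))%N.

Definition index_pred : pred T := fun b => [exists i : 'I_n, [exists j : 'I_n,
  connected_rows n lamf (row_val b) i j && in_range (row_val b) i j]].

Definition index_seq : seq (n.-tuple nat) := [seq tuple_of_ffun b | b in index_pred].

Lemma index_seq_uniq : uniq index_seq.
Proof. by rewrite map_inj_uniq ?enum_uniq //; apply: tuple_of_ffun_inj. Qed.

Lemma mem_index_seq (mu : n.-tuple nat) :
  mu \in index_seq <-> exists i j, connected_rows n lamf (nth 0%N mu) i j /\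
                                   in_range (nth 0%N mu) i j.
Proof.
split=> [/mapP[b + ->]|[i [j [h r]]]].
  rewrite mem_enum => /existsP[i /existsP[j /andP[h r]]]; exists i, j.
  by rewrite (eq_connected_rows _ _ _ (@nth_tuple_of_ffun b)) /in_range nth_tuple_of_ffun.
have ij := connected_rows_le h; have jn := connected_rows_lt h.
(* Since [mu_i - lam_j <= k], all parts are at most [lam_0 + k], so the finite type loses no
   shape. *)
have bound p : (nth 0%N mu p < N'.+1)%N.
  have mono := nth_partition lam_part.
  case: (boolP (i <= p <= j)%N) => [/andP[ip pj]|out].
    have := nth_partition (connected_rows_sorted lam_part h) ip.
    by have := mono 0%N j (leq0n _); move: r; rewrite /in_range; lia.
  by rewrite (connected_rows_out h out); have := mono 0%N p (leq0n _); lia.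
pose b : T := [ffun q : 'I_n => inord (nth 0%N mu q)].
have bE p : (p < n)%N -> row_val b p = nth 0%N mu p.
  by move=> pn; rewrite /row_val ffunE !inordK.
apply/mapP; exists b.
  rewrite mem_enum; apply/existsP; exists (Ordinal (leq_ltn_trans ij jn)).
  apply/existsP; exists (Ordinal jn).
  by rewrite (eq_connected_rows _ _ _ bE) h /in_range bE.
apply: eq_from_tnth => q; rewrite tnth_mktuple bE //; exact: tnth_nth.
Qed.

Lemma index_seqP (mu : n.-tuple nat) :
  mu \in index_seq <->
  [/\ sorted geq mu, part_le lam mu, (skew_cols lam mu <= k)%N,
      skew_connected lam mu
    & exists nu : n.-tuple nat,
        max_nw_ribbon lam mu nu /\ (k <= skew_size lam nu)%N].
Proof.
rewrite mem_index_seq; split=> [[i [j [h /andP[r1 r2]]]]|[h1 h2 h3 h4 h5]].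
  rewrite (connected_rows_cols lam_part h); split=> //.
  - exact: connected_rows_sorted h.
  - exact: connected_rows_part_le h.
  - exact: connected_rows_connected h.
  - exact/(max_nw_ribbonP lam_part h).
(* For [mu = lam] the only ribbon is empty, of size 0, which contradicts [k > 0]. *)
have ne : mu != lam.
  apply: contraTneq k_gt0 => e; case: h5 => nu [[[_ /part_leP l1 _ _] /part_leP l2 _]].
  have -> : nu = lam.
    apply: eq_from_tnth => q; rewrite !(tnth_nth 0%N).
    by apply/eqP; rewrite eqn_leq l1 andbT -e l2.
  by rewrite /skew_size subnn lt0n leqn0 negbK.
have [i [j h]] := connected_rows_exist lam_part h1 h2 h4 ne.
exists i, j; split=> //; rewrite /in_range -(connected_rows_cols lam_part h) h3 /=.
by rewrite (connected_rows_cols lam_part h); apply/(max_nw_ribbonP lam_part h).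
Qed.

Lemma chain_signE (R : comNzRingType) (mu : n.-tuple nat) i j :
  connected_rows n lamf (nth 0%N mu) i j ->
  chain_sign lamf R i j (nth 0%N mu) =
  (-1) ^+ (skew_size lam mu - skew_cols lam mu).
Proof.
move=> h; rewrite (connected_rows_size lam_part h) (connected_rows_cols lam_part h) addKn /chain_sign.
by rewrite (big_morph (fun e => (-1) ^+ e) (exprD (-1)) (expr0 (-1))).
Qed.

Lemma wedge_mul_psum (K : fieldType) (x : 'I_n -> K) :
  wedge (fun q => gcol x q (lamf q)) * power_sum k x =
  \sum_(mu <- index_seq)
    (-1) ^+ (skew_size lam mu - skew_cols lam mu)%N
    * ('C(skew_rows lam mu - 1, k - skew_cols lam mu))%:R
    * wedge (fun q => gcol x q (nth 0%N mu q)).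
Proof.
have mono := nth_partition lam_part.
have phiX l m i : x i ^+ k * gcol x l m i = gcol x l (m + k) i by exact: gcolX.
have lamN p : (lamf p < N'.+1)%N by have := mono 0%N p (leq0n _); lia.
have lamkN p : (lamf p + k < N'.+1)%N by have := mono 0%N p (leq0n _); lia.
rewrite /power_sum (wedge_mul_power_sum (nth_partition_succ lam_part) lamN
  (@gcolS _ _ x) phiX k_gt0 lamkN).
pose S (b : T) i j := connected_rows n lamf (row_val b) i j.
pose W (b : T) i j := binw K j (lamf j + k) i (row_val b i) *
   (chain_sign lamf K i j (row_val b) * wedge (fun q => gcol x q (row_val b q))).
rewrite big_image /=.
(* The shape becomes the outer index. At most one pair [(i, j)] then contributes, since the nonempty
   rows of a shape determine it. *)
transitivity (\sum_(b : T) \sum_(j < n) \sum_(i < n) if S b i j then W b i j else 0).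
  rewrite exchange_big /=; apply: eq_bigr => j _; rewrite exchange_big /=.
  have -> := big_ord_widen n (fun i => \sum_(b : T | S b i j) W b i j) (ltn_ord j).
  rewrite big_mkcond; apply: eq_bigr => i _ /=; rewrite -big_mkcond.
  by case: ifP => // ij; rewrite big1 // => b /connected_rowsP[]; rewrite -ltnS ij.
rewrite [RHS]big_mkcond; apply: eq_bigr => b _ /=.
have SE i j : S b i j = connected_rows n lamf (nth 0%N (tuple_of_ffun b)) i j.
  by apply: eq_connected_rows => p pn; rewrite nth_tuple_of_ffun.
case: ifP => [/existsP[i /existsP[j /andP[h r]]]|noQ].
  rewrite (bigD1 j) //= (bigD1 i) //= big1 ?big1 ?addr0.
  - rewrite ifT //; rewrite -/(S b i j) SE in h.
    rewrite -(chain_signE K h) (connected_rows_rows lam_part h) (connected_rows_cols lam_part h) /W.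
    have -> : chain_sign lamf K i j (nth 0%N (tuple_of_ffun b)) = chain_sign lamf K i j (row_val b).
      apply: eq_big_nat => p hp; rewrite nth_tuple_of_ffun //.
      by have := connected_rows_lt h; lia.
    rewrite nth_tuple_of_ffun // /binw ifT; last by move: r; rewrite /in_range; lia.
    have -> : wedge (fun q => gcol x q (nth 0%N (tuple_of_ffun b) q)) =
              wedge (fun q => gcol x q (row_val b q)).
      by apply: eq_wedge => q qn y; rewrite nth_tuple_of_ffun.
    have -> : (k - (row_val b i - lamf j) = lamf j + k - row_val b i)%N.
      have := connected_rows_col_le lam_part h; rewrite nth_tuple_of_ffun //.
      by move: r; rewrite /in_range; lia.
    by rewrite subn1 /=; ring.
  - move=> j' jj; rewrite big1 // => i' _; case: ifP => // h'.
    move: h h'; rewrite -/(S b i j) !SE => h h'.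
    have [_ e] := connected_rows_unique lam_part h h'.
    by case/eqP: jj; apply: val_inj.
  - move=> i' ii; case: ifP => // h'.
    move: h h'; rewrite -/(S b i j) !SE => h h'.
    have [e _] := connected_rows_unique lam_part h h'.
    by case/eqP: ii; apply: val_inj.
rewrite big1 // => j _; rewrite big1 // => i _; case: ifP => // h.
(* Outside the range the coefficient vanishes: by the cut-off if [c > k], and as a binomial with
   [k - c > r - 1] otherwise. *)
suff: binw K j (lamf j + k) i (row_val b i) = 0 by rewrite /W => ->; rewrite mul0r.
have nr : ~~ in_range (row_val b) i j.
  apply/negP => r; move/negbT/negP: noQ; apply; apply/existsP; exists i.
  by apply/existsP; exists j; rewrite -/(S b i j) h.
rewrite /binw; case: leqP => // mB; rewrite bin_small //.
rewrite SE in h; have := connected_rows_col_le lam_part h; have := connected_rows_le h.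
rewrite nth_tuple_of_ffun //.
by move: nr; rewrite /in_range; lia.
Qed.

End Expansion.

Theorem theorem3p1 (F : fieldType) (beta : F) (hbeta : beta != 0)
    (n k : nat) (hn : (1 <= n)%N) (hk : (1 <= k)%N)
    (lam : n.-tuple nat) (hlam : sorted geq lam) :
  exists s : seq (n.-tuple nat),
    [/\ uniq s,
        forall mu : n.-tuple nat,
          mu \in s <->
          [/\ sorted geq mu, part_le lam mu, (skew_cols lam mu <= k)%N,
              skew_connected lam mu
            & exists nu : n.-tuple nat,
                max_nw_ribbon lam mu nu /\ (k <= skew_size lam nu)%N]
      & Gtilde beta lam * psum F n k =
        \sum_(mu <- s)
          (-1) ^+ (skew_size lam mu - skew_cols lam mu)%N
          * ('C(skew_rows lam mu - 1, k - skew_cols lam mu))%:R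
          * Gtilde beta mu].
Proof.
case: n hn lam hlam => // n' _ lam hlam.
exists (index_seq k lam); split.
- exact: index_seq_uniq.
- by move=> mu; apply: index_seqP.
have c0 : ratfun_const n'.+1 beta != 0.
  by rewrite /ratfun_const tofrac_eq0 mpolyC_eq0.
rewrite /Gtilde /psum grothendieck_tildeE // -mulrA wedge_mul_psum // mulr_sumr.
by apply: eq_bigr => mu _; rewrite grothendieck_tildeE //; ring.
Qed.
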